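(* Let $\mathbb{F}_q$ be a finite field with $q$ elements, let $V$ be an $\mathbb{F}_q$-vector space of finite dimension $n\ge 1$, and let $G$ be a group acting linearly on $V$. Then for every pair $(j,k)$ of elements of $\{1,\dots,n-1\}$ such that $\#G(j,V)\le\#G(k,V)$, one has $$N(G,G(j,V))\le N(G,G(k,V)).$$
   Context: For $r\in\{1,\dots,n-1\}$, $G(r,V)$ denotes the (finite) set of $r$-dimensional $\mathbb{F}_q$-linear subspaces of $V$; the action of $G$ on $V$ induces an action of $G$ on $G(r,V)$. For a finite set $E$, $\#E$ is its cardinality, and if a group $G$ acts on $E$, $N(G,E)$ is the number of orbits of this action. *)

(* Defs.v *)
From HB Require Import structures.
From mathcomp Require Import all_boot all_order all_fingroup all_algebra.
From mathcomp Require Import boolp.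

Set Implicit Arguments.
Unset Strict Implicit.
Unset Printing Implicit Defensive.

Import GRing.Theory VectorInternalTheory.
Local Open Scope ring_scope.

(* A subspace is stored as a square matrix of coordinates in canonical form,
   so there are finitely many of them when the field of scalars is finite.    *)
HB.instance Definition _ (F : finFieldType) (V : vectType F) :=
  [Countable of {vspace V} by <:].
HB.instance Definition _ (F : finFieldType) (V : vectType F) :=
  [Finite of {vspace V} by <:].

(* A left linear action of an arbitrary, possibly infinite, group; the two
   conditions force every [rho g] to be invertible.                           *)
Definition linear_action (F : fieldType) (V : vectType F) (G : groupType)
    (rho : G -> 'End(V)) : Prop :=
  rho 1%g = \1%VF /\ forall g h : G, rho (g * h)%g = (rho g \o rho h)%VF.

Definition grassmannian (F : finFieldType) (V : vectType F) (r : nat) :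
    {set {vspace V}} :=
  [set U : {vspace V} | \dim U == r].

Definition subspace_act (F : fieldType) (V : vectType F) (G : groupType)
    (rho : G -> 'End(V)) (g : G) (U : {vspace V}) : {vspace V} :=
  (rho g @: U)%VS.

(* MathComp's [orbit] needs a finite acting group. *)
Definition orbit_of (G : groupType) (T : finType) (act : G -> T -> T) (x : T) :
    {set T} :=
  [set y | `[< exists g : G, y = act g x >]].

(* Meaningful when [act] is a group action that preserves [E]. *)
Definition num_orbits (G : groupType) (T : finType) (act : G -> T -> T)
    (E : {set T}) : nat :=
  #|[set orbit_of act x | x in E]|.

(* Main.v *)
Require Import Defs.
From mathcomp Require Import all_boot all_order all_fingroup all_algebra.
From mathcomp Require Import finfield boolp zify.

(** Let [n] be the dimension of [V] and let [A] be the matrix of the covering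
relation ([x <= y] and [dim y = dim x + 1]) on the finite lattice of all
subspaces of [V]. Write [[m]] for the number [1 + q + ... + q^(m-1)]. A subspace
of dimension [r] is covered by [[n - r]] subspaces and covers [[r]] of them,
while two distinct subspaces have as many common upper covers as common lower
covers (one or none). Hence the sl2-like relation
[A A^T - A^T A = diag ([n - r] - [r])] ([cover_mx_commutator]).

If [v] is a row vector supported on the subspaces of dimension [r], this
relation gives [v A^m A^T = (v A^T A + s v) A^(m-1)], where [s] is the sum of
[[n - i] - [i]] over [r <= i < r + m]; it is positive when [0 < m] and
[2 r + m <= n]. If [v A^m = 0], induction on [m] yields [v A^T A = - s v], and
pairing with [v] gives [|v A^T|^2 = - s |v|^2], so [v = 0]
([exp_inj_homog]). Therefore [A^(k-j)] is injective from the functions on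
[G(j,V)] to those on [G(k,V)] when [j <= k] and [j + k <= n]. The relation is
preserved by transposing [A] and replacing [r] by [n - r], so
[(A^T)^(j-k)] is injective from [G(j,V)] to [G(k,V)] when [k <= j] and
[n <= j + k].

When [#G(j,V) <= #G(k,V)], there is thus in every case a [G]-invariant matrix
with independent rows indexed by [G(j,V)] and columns indexed by [G(k,V)]: if
the injectivity at hand goes from [k] to [j], the matrix is square and its
transpose is injective too ([kernel_inj_tr]). Restricted to
invariant functions, such a matrix embeds a space of dimension
[N(G, G(j,V))] into one of dimension [N(G, G(k,V))] ([leq_num_orbits]). *)

Set Implicit Arguments.
Unset Strict Implicit.
Unset Printing Implicit Defensive.

Import Order.TTheory GRing.Theory Num.Theory.
Local Open Scope ring_scope.

(** * Injectivity of powers of a graded matrix *)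

Section GradedCommutator.
Variables (R : realFieldType) (N : nat).
Implicit Types (A : 'M[R]_N) (rk : 'I_N -> nat) (h : nat -> R) (v : 'rV[R]_N).

(** [A] maps row vectors of degree [r] to row vectors of degree [r + 1]. *)
Definition raises A rk := forall i j, A i j != 0 -> rk j = (rk i).+1.

(** [v] is homogeneous of degree [r]: it is supported on the indices of rank
[r]. The zero vector is homogeneous of every degree. *)
Definition homog rk r v := forall i, v 0 i != 0 -> rk i = r.

Lemma mulmx_neq0 m n p (B : 'M[R]_(m, n)) (C : 'M_(n, p)) i j :
  (B *m C) i j != 0 -> exists2 l, B i l != 0 & C l j != 0.
Proof.
rewrite mxE => nz; have [l /= nzl|z] := pickP (fun l => B i l * C l j != 0).
  by exists l; apply: contraNneq nzl => ->; rewrite ?mul0r ?mulr0.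
by case/eqP: nz; apply: big1 => l _; apply/eqP; have /negbFE := z l.
Qed.

Lemma raises_exp A rk m i j :
  raises A rk -> (A ^+ m) i j != 0 -> rk j = (rk i + m)%N.
Proof.
move=> Ark; elim: m j => [|m IH] j.
  by rewrite expr0 mxE addn0; have [->|_] := eqVneq i j; rewrite ?eqxx.
by rewrite exprSr => /mulmx_neq0[l /IH rl /Ark ->]; rewrite rl addnS.
Qed.

Lemma trmx_exp A m : (A ^+ m)^T = A^T ^+ m.
Proof.
elim: m => [|m IH]; first by rewrite !expr0 trmx1.
by rewrite exprS exprSr trmx_mul IH.
Qed.

Lemma homog_up A rk r v :
  raises A rk -> homog rk r v -> homog rk r.+1 (v *m A).
Proof. by move=> Ark hv i /mulmx_neq0[l /hv <- /Ark]. Qed.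

Lemma homog_down_up A rk r v :
  raises A rk -> homog rk r v -> homog rk r (v *m A^T *m A).
Proof.
move=> Ark hv i /mulmx_neq0[l /mulmx_neq0[l' /hv <-]].
by rewrite mxE => /Ark -> /Ark.
Qed.

Lemma homog_diag rk h r v :
  homog rk r v -> v *m diag_mx (\row_i h (rk i)) = h r *: v.
Proof.
move=> hv; apply/rowP => i; rewrite mul_mx_diag !mxE mulrC.
by have [->|/hv ->] := eqVneq (v 0 i) 0; rewrite ?mulr0.
Qed.

Lemma mulmx_expS p A m (B : 'M_(p, N)) : B *m A ^+ m.+1 = B *m A *m A ^+ m.
Proof. by rewrite exprS -mulmxA. Qed.

(** For [m = 0] the sum is empty, so the value of [m.-1] does not matter. *)
Lemma exp_commutator A rk h r m v :
    raises A rk -> A *m A^T - A^T *m A = diag_mx (\row_i h (rk i)) ->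
    homog rk r v ->
  v *m A ^+ m *m A^T =
    v *m A^T *m A ^+ m + (\sum_(i < m) h (r + i)%N) *: (v *m A ^+ m.-1).
Proof.
move=> Ark comm; elim: m r v => [|m IH] r v hv.
  by rewrite big_ord0 scale0r addr0 !mulmx1.
have vAAt : v *m A *m A^T = v *m A^T *m A + h r *: v.
  by rewrite -(homog_diag h hv) -comm mulmxBr !mulmxA addrC subrK.
rewrite !mulmx_expS (IH _ _ (homog_up Ark hv)) vAAt.
rewrite mulmxDl -scalemxAl -addrA; congr (_ + _).
rewrite big_ord_recl /= addn0 scalerDl; congr (_ + _).
case: m {IH} => [|m]; first by rewrite !big_ord0 !scale0r.
rewrite mulmx_expS /=.
by congr (_ *: _); apply: eq_bigr => i _; rewrite addSnnS.
Qed.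

Lemma sqr_row_ge0 n (w : 'rV[R]_n) : 0 <= (w *m w^T) 0 0.
Proof. by rewrite mxE sumr_ge0 // => i _; rewrite mxE -expr2 sqr_ge0. Qed.

Lemma sqr_row_eq0 n (w : 'rV[R]_n) : (w *m w^T) 0 0 = 0 -> w = 0.
Proof.
rewrite mxE => /eqP; rewrite psumr_eq0 => [/allP w0|i _]; last first.
  by rewrite mxE -expr2 sqr_ge0.
apply/rowP => i; rewrite mxE; apply/eqP.
by have := w0 i (mem_index_enum i); rewrite mxE -expr2 sqrf_eq0.
Qed.

(** The analogue of the injectivity of the raising operator of sl2 below the
middle weight; positivity of [v A^T A v^T] replaces the representation
theory. *)
Lemma exp_inj_homog A rk h r m v :
    raises A rk -> A *m A^T - A^T *m A = diag_mx (\row_i h (rk i)) ->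
    (forall m', (0 < m' <= m)%N -> 0 < \sum_(i < m') h (r + i)%N) ->
    homog rk r v -> v *m A ^+ m = 0 -> v = 0.
Proof.
move=> Ark comm; elim: m v => [|m IH] v hpos hv.
  by rewrite expr0 mulmx1.
move=> vAm0; set s := \sum_(i < m.+1) h (r + i)%N.
have s_gt0 : 0 < s by apply: hpos; rewrite /= leqnn.
(* This vector is homogeneous of degree [r] and killed by [A ^+ m]. *)
have w0 : v *m A^T *m A + s *: v = 0.
  apply: IH => [m' /andP[m'0 lem']|i|].
  - by apply: hpos; rewrite m'0 ltnW.
  - have [v0|/hv //] := eqVneq (v 0 i) 0.
    rewrite mxE [(s *: v) 0 i]mxE v0 mulr0 addr0.
    exact: (homog_down_up Ark hv).
  - have := exp_commutator m.+1 Ark comm hv; rewrite vAm0 mul0mx /= => /esym.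
    by rewrite mulmx_expS mulmxDl -scalemxAl.
have : (v *m A^T *m (v *m A^T)^T + s *: (v *m v^T)) 0 0 = 0.
  by rewrite trmx_mul trmxK mulmxA scalemxAl -mulmxDl w0 mul0mx mxE.
rewrite mxE [X in _ + X]mxE => /eqP.
rewrite paddr_eq0 ?sqr_row_ge0 ?mulr_ge0 ?sqr_row_ge0 ?ltW // => /andP[_].
by rewrite mulf_eq0 gt_eqF //= => /eqP/sqr_row_eq0.
Qed.

End GradedCommutator.

(** * Injective kernels and orbit counting *)

Section Kernels.
Variable T : finType.
Implicit Types (E : {set T}).

(** The operator with kernel [K], from functions on [E] to functions on [E'], is
injective. Functions are defined on the whole of [T], and only their values on
[E] matter. *)
Definition kernel_inj (R : numFieldType) (E E' : {set T}) (K : T -> T -> R) :=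
  forall f : T -> R, (forall y, y \in E' -> \sum_(x in E) f x * K x y = 0) ->
  forall x, x \in E -> f x = 0.

(** The matrix of this operator, acting on row vectors. *)
Definition kernel_mx (R : numFieldType) (E E' : {set T}) (K : T -> T -> R) :
    'M[R]_(#|E|, #|E'|) :=
  \matrix_(i, j) K (enum_val i) (enum_val j).

Lemma row_free_kernel_mx (R : numFieldType) E E' (K : T -> T -> R) :
  kernel_inj E E' K -> row_free (kernel_mx E E' K).
Proof.
move=> Kinj; apply: inj_row_free => v vK.
(* [v] as a function on [T], extended by [0] outside [E]. *)
pose f x := oapp (v 0) 0 [pick i : 'I_#|E| | enum_val i == x].
have fE i : f (enum_val i) = v 0 i.
  rewrite /f; case: pickP => [j /eqP/enum_val_inj -> //|/(_ i)].
  by rewrite eqxx.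
apply/rowP => i; rewrite mxE -fE; apply: Kinj (enum_valP i) => y yE'.
rewrite big_enum_val /=; move/rowP/(_ (enum_rank_in yE' y)): vK.
rewrite !mxE => vK; rewrite -[RHS]vK; apply: eq_bigr => l _.
by rewrite fE mxE enum_rankK_in.
Qed.

(** An injective operator whose target is not larger than its source is
bijective, hence so is its transpose. *)
Lemma kernel_inj_tr (R : numFieldType) E E' (K : T -> T -> R) :
  kernel_inj E E' K -> (#|E'| <= #|E|)%N ->
  kernel_inj E' E (fun y x => K x y).
Proof.
move=> /row_free_kernel_mx Kfree leE'E f f0 y yE'.
have Kfull : row_free (kernel_mx E E' K)^T.
  rewrite /row_free mxrank_tr eqn_leq rank_leq_col /=.
  by move: Kfree; rewrite /row_free => /eqP ->.
have : \row_j f (enum_val j) *m (kernel_mx E E' K)^T = 0.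
  apply/rowP => i; rewrite [RHS]mxE -(f0 _ (enum_valP i)) big_enum_val mxE.
  by apply: eq_bigr => j _; rewrite !mxE.
rewrite -[X in _ = X](mul0mx _ (kernel_mx E E' K)^T) => /(row_free_inj Kfull).
move/rowP/(_ (enum_rank_in yE' y)).
by rewrite !mxE enum_rankK_in.
Qed.

(** [exp_inj_homog] in terms of functions on the elements of given ranks. *)
Lemma kernel_inj_exp (R : realFieldType) (A : 'M[R]_#|T|) (rk : T -> nat)
    (h : nat -> R) r m :
    raises A (fun i => rk (enum_val i)) ->
    A *m A^T - A^T *m A = diag_mx (\row_i h (rk (enum_val i))) ->
    (forall m', (0 < m' <= m)%N -> 0 < \sum_(i < m') h (r + i)%N) ->
  kernel_inj [set x | rk x == r] [set x | rk x == (r + m)%N]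
    (fun x y => (A ^+ m) (enum_rank x) (enum_rank y)).
Proof.
move=> Ark comm hpos f f0 x xr.
pose v : 'rV[R]_#|T| :=
  \row_i (if rk (enum_val i) == r then f (enum_val i) else 0).
have hv : homog (fun i => rk (enum_val i)) r v.
  move=> i; rewrite mxE; have [//|_] := eqVneq (rk (enum_val i)) r.
  by rewrite eqxx.
have v0 : v = 0.
  apply: (exp_inj_homog Ark comm hpos hv); apply/rowP => i; rewrite [RHS]mxE.
  have vE : (v *m A ^+ m) 0 i =
      \sum_(x in [set x | rk x == r]) f x * (A ^+ m) (enum_rank x) i.
    rewrite mxE (reindex enum_rank) /=; last exact/onW_bij/enum_rank_bij.
    rewrite [RHS]big_mkcond; apply: eq_bigr => z _.
    by rewrite mxE enum_rankK inE; case: eqP; rewrite ?mul0r.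
  (* Outside the degree [r + m], [v *m A ^+ m] vanishes by homogeneity. *)
  have [ri|nri] := eqVneq (rk (enum_val i)) (r + m)%N.
    by rewrite vE -(enum_valK i) f0 // inE ri.
  rewrite vE big1 // => z; rewrite inE => /eqP rz.
  have [->|/(raises_exp Ark)] := eqVneq ((A ^+ m) (enum_rank z) i) 0.
    by rewrite mulr0.
  by rewrite enum_rankK rz => e; rewrite e eqxx in nri.
move/rowP/(_ (enum_rank x)): v0; rewrite !mxE enum_rankK.
by move: xr; rewrite inE => ->.
Qed.

Variables (G : groupType) (act : G -> T -> T).
Hypothesis act1 : forall x, act 1%g x = x.
Hypothesis actM : forall g h x, act (g * h)%g x = act g (act h x).

Lemma actK g : cancel (act g) (act g^-1%g).
Proof. by move=> x; rewrite -actM mulVg act1. Qed.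

Lemma orbit_ofP x y :
  reflect (exists g : G, y = act g x) (y \in orbit_of act x).
Proof. by rewrite inE; apply: asboolP. Qed.

Lemma orbit_of_refl x : x \in orbit_of act x.
Proof. by apply/orbit_ofP; exists 1%g; rewrite act1. Qed.

Lemma orbit_of_act g x y :
  (act g y \in orbit_of act x) = (y \in orbit_of act x).
Proof.
apply/orbit_ofP/orbit_ofP => [[h e]|[h ->]]; last first.
  by exists (g * h)%g; rewrite actM.
by exists (g^-1 * h)%g; rewrite actM -e actK.
Qed.

Lemma orbit_of_eq x y :
  y \in orbit_of act x -> orbit_of act y = orbit_of act x.
Proof.
case/orbit_ofP=> g ->; apply/setP => z.
apply/orbit_ofP/orbit_ofP => -[h ->]; first by exists (h * g)%g; rewrite actM.
by exists (h * g^-1)%g; rewrite actM actK.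
Qed.

(** The indicators of the orbits in [E] form a basis of the invariant functions
on [E]. On it the operator is given by a row free matrix whose columns are
indexed by the orbits that meet [E'], so there are at least as many of these. *)
Lemma leq_num_orbits (R : numFieldType) E E' (K : T -> T -> R) :
    (forall g x, (act g x \in E) = (x \in E)) ->
    (forall g x y, K (act g x) (act g y) = K x y) ->
  kernel_inj E E' K -> (num_orbits act E <= num_orbits act E')%N.
Proof.
move=> Estable Kinv Kinj; rewrite /num_orbits.
set O := [set orbit_of act x | x in E].
set O' := [set orbit_of act y | y in E'].
(* Summing [K x y] over all [y] in an orbit, rather than fixing one, scales each
   column by a nonzero factor and avoids choosing representatives. *)
pose P : 'M[R]_(#|O|, #|O'|) := \matrix_(a < #|O|, b < #|O'|)
  \sum_(y in (enum_val b : {set T})) \sum_(x in E)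
    (x \in (enum_val a : {set T}))%:R * K x y.
suff /eqP <- : row_free P by apply: rank_leq_col.
apply: inj_row_free => v vP.
(* The invariant function on [E] with coordinates [v]. *)
pose f x := \sum_(a < #|O|) v 0 a * (x \in (enum_val a : {set T}))%:R.
have Oact g x (a : 'I_#|O|) :
    (act g x \in (enum_val a : {set T})) = (x \in (enum_val a : {set T})).
  by have /imsetP[z _ ->] := enum_valP a; rewrite orbit_of_act.
have finv g x : f (act g x) = f x.
  by apply: eq_bigr => a _; rewrite Oact.
pose gf y := \sum_(x in E) f x * K x y.
have ginv g y : gf (act g y) = gf y.
  rewrite /gf (reindex_inj (can_inj (actK g))) /=.
  by apply: eq_big => [x|x _]; rewrite ?Estable // finv Kinv.
have f0 x : x \in E -> f x = 0.
  apply: Kinj => y yE'.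
  have yO' : orbit_of act y \in O' by apply: imset_f.
  move/rowP/(_ (enum_rank_in yO' (orbit_of act y))): vP; rewrite !mxE => vP.
  have : gf y *+ #|orbit_of act y| = 0.
    rewrite -sumr_const -[RHS]vP.
    transitivity (\sum_(z in orbit_of act y) gf z).
      by apply: eq_bigr => z /orbit_ofP[g ->]; rewrite ginv.
    under [RHS]eq_bigr => a _ do rewrite mxE enum_rankK_in // mulr_sumr.
    rewrite [RHS]exchange_big /=; apply: eq_bigr => z _.
    under [RHS]eq_bigr => a _ do rewrite mulr_sumr.
    rewrite [RHS]exchange_big /=; apply: eq_bigr => x' _.
    by rewrite mulr_suml; apply: eq_bigr => a _; rewrite mulrA.
  move/eqP; rewrite mulrn_eq0 => /orP[|/eqP //].
  by rewrite cards_eq0 => /eqP e; have := orbit_of_refl y; rewrite e inE.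
apply/rowP => a; rewrite mxE; have /imsetP[x xE ea] := enum_valP a.
rewrite -[RHS](f0 x xE) /f (bigD1 a) //= ea orbit_of_refl mulr1.
rewrite big1 ?addr0 // => b neba.
have /imsetP[z _ eb] := enum_valP b.
have [xb|_] := boolP (x \in (enum_val b : {set T})); last first.
  by rewrite mulr0.
case/eqP: neba; apply: enum_val_inj; rewrite ea eb; apply/esym.
by apply: orbit_of_eq; rewrite -eb.
Qed.

End Kernels.

(** * Gaussian integers *)

(** The [q]-analogue of [m], that is [(q ^ m - 1) / (q - 1)] when [q > 1]. *)
Definition qnum (q m : nat) : nat := \sum_(i < m) q ^ i.

Lemma ltn_qnum q m m' : (0 < q)%N -> (m < m')%N -> (qnum q m < qnum q m')%N.
Proof.
move=> q_gt0; elim: m' => // m' IH; rewrite ltnS leq_eqVlt.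
rewrite /qnum big_ord_recr /=.
have qm : (0 < q ^ m')%N by rewrite expn_gt0 q_gt0.
case/orP=> [/eqP->|/IH lt]; first by rewrite -ltn_subLR // subnn.
exact: (leq_trans lt (leq_addr _ _)).
Qed.

Lemma sum_qnum_gt0 (R : numDomainType) q n r m : (0 < q)%N ->
    (0 < m)%N -> (r + r + m <= n)%N ->
  0 < \sum_(i < m) ((qnum q (n - (r + i)))%:R - (qnum q (r + i))%:R) :> R.
Proof.
move=> q_gt0 m_gt0 le_n; rewrite sumrB subr_gt0.
(* After reversing the second sum, the terms compare one by one. *)
rewrite (reindex_inj rev_ord_inj) /=.
apply: ltr_sum => [|i _].
  by apply/hasP; exists (Ordinal m_gt0); rewrite ?mem_index_enum.
by rewrite ltr_nat ltn_qnum //; have := ltn_ord i; lia.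
Qed.

(** * The covering relation on subspaces *)

Lemma sum_natr_and (R : pzSemiRingType) (T : finType) (P Q : pred T) :
  \sum_z (P z)%:R * (Q z)%:R = #|[set z | P z && Q z]|%:R :> R.
Proof.
rewrite -[in RHS]sum1_card natr_sum [RHS]big_mkcond; apply: eq_bigr => z _.
by rewrite inE; case: (P z); rewrite ?mul0r ?mul1r //; case: (Q z).
Qed.

Section Covers.
Variables (F : finFieldType) (V : vectType F).
Implicit Types x y z : {vspace V}.

(** [y] covers [x] in the lattice of subspaces. *)
Definition covers x y := (x <= y)%VS && (\dim y == (\dim x).+1).

(** [finvect_type V] is the type [V] itself, with its structure of finite
type. *)
Lemma card_vectors x :
  #|[set v : finvect_type V | (v : V) \in x]| = (#|F| ^ \dim x)%N.
Proof.
case: V x => T cvT x.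
by rewrite -(@card_vspace F (finvect_type (Vector.Pack cvT)) cvT x) cardsE.
Qed.

Lemma dim_add_line z (v : V) : v \notin z -> \dim (z + <[v]>)%VS = (\dim z).+1.
Proof.
move=> vz; apply/eqP; rewrite eqn_leq; apply/andP; split.
  apply: leq_trans (dimv_add_leqif z <[v]>).1 _.
  by rewrite dim_vline -addn1 leq_add2l; case: (v != 0).
rewrite ltn_neqAle dimvS ?addvSl // andbT.
apply: contra vz => /eqP e; have /eqP -> : z == (z + <[v]>)%VS.
  by rewrite eqEdim addvSl e leqnn.
by rewrite memvE addvSr.
Qed.

Lemma covers_add_line z y (v : V) : covers z y -> v \notin z ->
  ((z + <[v]>)%VS == y) = (v \in y).
Proof.
case/andP=> zy /eqP dy vz; apply/eqP/idP => [<-|vy].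
  by rewrite memvE addvSr.
by apply/eqP; rewrite eqEdim subv_add zy -memvE vy dim_add_line // dy leqnn.
Qed.

(** Each such [y] is [z + <[v]>] for exactly the [v] in [y] outside [z], and
these sets of vectors partition the complement of [z] in [x]. *)
Lemma card_covers_below z x : (z <= x)%VS ->
  #|[set y | covers z y & (y <= x)%VS]| = qnum #|F| (\dim x - \dim z).
Proof.
move=> zx; set S := [set y | _ & _]; set q := #|F|.
have q_gt1 : (1 < q)%N := card_finNzRing_gt1 F.
pose vs (U : {vspace V}) := [set v : finvect_type V | (v : V) \in U].
have diffE U : (z <= U)%VS -> #|vs U :\: vs z| = (q ^ \dim U - q ^ \dim z)%N.
  move=> zU; rewrite cardsDS ?card_vectors //.
  by apply/subsetP => v; rewrite !inE; apply: (subvP zU).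
have : #|vs x :\: vs z| = (#|S| * (q ^ (\dim z).+1 - q ^ \dim z))%N.
  rewrite -sum1_card.
  rewrite (partition_big
    (fun v : finvect_type V => (z + <[v : V]>)%VS) (mem S)) /=.
    rewrite -sum_nat_const; apply: eq_bigr => y; rewrite inE => /andP[zy yx].
    have /andP[zy' /eqP dy] := zy.
    rewrite -dy -diffE // -sum1_card; apply: eq_bigl => v; rewrite !inE.
    case vz: ((v : V) \in z) => //=; rewrite (covers_add_line zy) ?vz //.
    by case vy: ((v : V) \in y); rewrite ?andbF // (subvP yx).
  move=> v; rewrite !inE => /andP[vz vx].
  by rewrite /covers addvSl dim_add_line // eqxx subv_add zx -memvE.
rewrite diffE //; set s := \dim z; set c := qnum q _.
have -> : (q ^ \dim x - q ^ s = q ^ s * q.-1 * c)%N.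
  by rewrite -mulnA -predn_exp -subn1 mulnBr muln1 -expnD subnKC ?dimvS.
have -> : (q ^ s.+1 - q ^ s = q ^ s * q.-1)%N.
  by rewrite expnSr -subn1 mulnBr muln1.
rewrite mulnC => /eqP; rewrite eqn_pmul2r => [/eqP //|].
by rewrite muln_gt0 expn_gt0 (ltnW q_gt1) -subn1 subn_gt0.
Qed.

Lemma common_upper_cover x y z : x != y ->
  covers x z && covers y z =
    [&& z == (x + y)%VS, \dim x == \dim y & \dim (x + y) == (\dim x).+1].
Proof.
move=> nexy; apply/andP/and3P=> [[/andP[xz dxz] /andP[yz dyz]]|[/eqP -> dxy d]].
  have dxy : \dim x = \dim y by apply/eqP; rewrite -eqSS -(eqP dxz).
  have sxyz : (x + y <= z)%VS by rewrite subv_add xz.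
  have lt : (\dim x < \dim (x + y))%N.
    rewrite ltn_neqAle dimvS ?addvSl // andbT; apply: contra nexy => /eqP e.
    have /eqP-> : x == (x + y)%VS by rewrite eqEdim addvSl e leqnn.
    by rewrite eq_sym eqEdim addvSr -e dxy leqnn.
  have ez : z == (x + y)%VS by rewrite eq_sym eqEdim sxyz (eqP dxz).
  by rewrite -(eqP ez) dxz dxy.
by rewrite /covers addvSl addvSr -(eqP dxy) d.
Qed.

Lemma common_lower_cover x y z : x != y ->
  covers z x && covers z y =
    [&& z == (x :&: y)%VS, \dim x == \dim y & \dim (x + y) == (\dim x).+1].
Proof.
move=> nexy; have dsum := dimv_sum_cap x y.
apply/andP/and3P=> [[/andP[xz dxz] /andP[yz dyz]]|[/eqP -> dxy d]].
  have dxy : \dim x = \dim y by rewrite (eqP dxz) (eqP dyz).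
  have sxyz : (z <= x :&: y)%VS by rewrite subv_cap xz.
  have lt : (\dim (x :&: y) < \dim x)%N.
    rewrite ltn_neqAle dimvS ?capvSl // andbT; apply: contra nexy => /eqP e.
    have /eqP<- : (x :&: y)%VS == x by rewrite eqEdim capvSl e leqnn.
    by rewrite eqEdim capvSr e dxy leqnn.
  have ez : z == (x :&: y)%VS by rewrite eqEdim sxyz -ltnS -(eqP dxz).
  by split; rewrite ?ez ?dxy //; move: dsum dxz; rewrite -(eqP ez) dxy; lia.
by rewrite /covers capvSl capvSr; move: dsum d dxy; lia.
Qed.

(** The covering relation as a matrix indexed by all the subspaces of [V]. *)
Definition cover_mx : 'M[rat]_#|{: {vspace V}}| :=
  \matrix_(i, j) (covers (enum_val i) (enum_val j))%:R.

(** The number of saturated chains of length [m] from [x] to [y]. *)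
Definition chains m x y : rat := (cover_mx ^+ m) (enum_rank x) (enum_rank y).

Lemma cover_mxE x y :
  cover_mx (enum_rank x) (enum_rank y) = (covers x y)%:R.
Proof. by rewrite mxE !enum_rankK. Qed.

Lemma chains0 x y : chains 0 x y = (x == y)%:R.
Proof. by rewrite /chains expr0 mxE (inj_eq enum_rank_inj). Qed.

Lemma sum_chains m m' x y :
  chains (m + m') x y = \sum_z chains m x z * chains m' z y.
Proof.
rewrite /chains exprD mxE (reindex enum_rank) //=.
exact/onW_bij/enum_rank_bij.
Qed.

Lemma chains1 x y : chains 1 x y = (covers x y)%:R.
Proof. exact: cover_mxE. Qed.

Lemma chains_neq0 m x y :
  chains m x y != 0 -> (x <= y)%VS /\ \dim y = (\dim x + m)%N.
Proof.
elim: m y => [|m IH] y.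
  by rewrite chains0 addn0; have [->|] := eqVneq x y; rewrite ?eqxx.
rewrite -addn1 sum_chains => nz.
have [z /= nzz|zz] := pickP (fun z => chains m x z * chains 1 z y != 0);
  last first.
  by case/eqP: nz; apply: big1 => z _; apply/eqP; have /negbFE := zz z.
move: nzz; rewrite mulf_eq0 negb_or chains1 pnatr_eq0 eqb0 negbK.
case/andP=> /IH[xz dz] /andP[zy /eqP dy]; split; first exact: subv_trans zy.
by rewrite dy dz addn1 addnS.
Qed.

(** Chains are counted by choosing their elements from the bottom up. *)
Lemma chains_fact m x y : (x <= y)%VS -> \dim y = (\dim x + m)%N ->
  chains m x y = \prod_(i < m) (qnum #|F| i.+1)%:R.
Proof.
elim: m x => [|m IH] x xy dy.
  by rewrite big_ord0 chains0 eqEdim xy dy addn0 leqnn.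
rewrite -add1n sum_chains add1n big_ord_recr /=.
have /(congr1 (fun n => n%:R : rat)) := card_covers_below xy.
rewrite dy addKn => <-; rewrite -sum1_card natr_sum mulr_sumr.
rewrite [LHS](bigID (mem [set z | covers x z & (z <= y)%VS])) /=.
rewrite [X in _ + X]big1 ?addr0 => [|z]; last first.
  rewrite inE negb_and chains1; case: (covers x z) => //=; rewrite ?mul0r //.
  have [->|/chains_neq0[-> //]] := eqVneq (chains m z y) 0.
  by rewrite mulr0.
apply: eq_bigr => z; rewrite inE => /andP[xz zy].
rewrite chains1 xz mul1r mulr1; apply: IH => //.
by rewrite dy; case/andP: xz => _ /eqP ->; rewrite addSnnS.
Qed.

(** Counting the maximal chains of [x] by their last step compares the number of
hyperplanes of [x] with the bottom-up count [chains_fact]. *)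
Lemma card_covered x : #|[set z | covers z x]| = qnum #|F| (\dim x).
Proof.
case dx : (\dim x) => [|m].
  rewrite /qnum big_ord0; apply/eqP; rewrite cards_eq0; apply/eqP/setP => z.
  by rewrite !inE /covers dx andbF.
have pos : \prod_(i < m) (qnum #|F| i.+1)%:R != 0 :> rat.
  apply/prodf_neq0 => i _; rewrite pnatr_eq0 -lt0n.
  apply: leq_trans (ltn_qnum (m := 0) _ (ltn0Sn i)) => //.
  by apply/card_gt0P; exists 0.
apply/eqP; rewrite -(eqr_nat rat) -(inj_eq (mulfI pos)); apply/eqP.
rewrite -[RHS](big_ord_recr m
  (fun i : 'I_m.+1 => (qnum #|F| i.+1)%:R : rat)) /=.
have <- : chains m.+1 0 x = \prod_(i < m.+1) (qnum #|F| i.+1)%:R.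
  by apply: chains_fact; rewrite ?sub0v // dimv0.
rewrite -addn1 sum_chains -[X in X%:R]sum1_card natr_sum mulr_sumr.
rewrite [RHS](bigID (mem [set z | covers z x])) /=.
rewrite [X in _ = _ + X]big1 ?addr0 => [|z]; last first.
  by rewrite inE chains1 => /negbTE ->; rewrite mulr0.
apply: eq_bigr => z; rewrite inE => zx; rewrite chains1 zx !mulr1; apply/esym.
apply: chains_fact; rewrite ?sub0v // dimv0.
by case/andP: zx; rewrite dx eqSS => _ /eqP <-.
Qed.

Lemma card_covering x :
  #|[set z | covers x z]| = qnum #|F| (\dim {:V} - \dim x).
Proof.
rewrite -(card_covers_below (subvf x)); apply: eq_card => z.
by rewrite !inE subvf andbT.
Qed.

(** The number of upper covers minus the number of lower covers of a subspace of
dimension [r]. *)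
Definition rank_gap (r : nat) : rat :=
  (qnum #|F| (\dim {:V} - r))%:R - (qnum #|F| r)%:R.

(** The dimension of the subspace of given index. *)
Definition dim_index (i : 'I_#|{: {vspace V}}|) := \dim (enum_val i).

Lemma cover_mx_commutator :
  cover_mx *m cover_mx^T - cover_mx^T *m cover_mx =
    diag_mx (\row_i rank_gap (dim_index i)).
Proof.
apply/matrixP => i j; rewrite -(enum_valK i) -(enum_valK j).
move: (enum_val i) (enum_val j) => x y {i j}.
have upE : (cover_mx *m cover_mx^T) (enum_rank x) (enum_rank y) =
    #|[set z | covers x z && covers y z]|%:R.
  rewrite mxE (reindex enum_rank) /=; last exact/onW_bij/enum_rank_bij.
  rewrite -sum_natr_and; apply: eq_bigr => z _.
  by rewrite [cover_mx^T _ _]mxE !cover_mxE.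
have downE : (cover_mx^T *m cover_mx) (enum_rank x) (enum_rank y) =
    #|[set z | covers z x && covers z y]|%:R.
  rewrite mxE (reindex enum_rank) /=; last exact/onW_bij/enum_rank_bij.
  rewrite -sum_natr_and; apply: eq_bigr => z _.
  by rewrite [cover_mx^T _ _]mxE !cover_mxE.
rewrite [LHS]mxE upE [X in _ + X]mxE downE !mxE (inj_eq enum_rank_inj).
have [<-|nexy] := eqVneq x y.
  rewrite mulr1n /rank_gap /dim_index enum_rankK -card_covering -card_covered.
  by congr (_%:R - _%:R); apply: eq_card => z; rewrite !inE andbb.
apply/eqP; rewrite mulr0n subr_eq0 eqr_nat; apply/eqP.
(* If [P] holds, the only common upper cover is [x + y] and the only common
   lower cover is [x :&: y]; otherwise there is none of either kind. *)
pose P := (\dim x == \dim y) && (\dim (x + y) == (\dim x).+1).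
transitivity (P : nat).
  transitivity #|[set z | (z == (x + y)%VS) && P]|.
    by apply: eq_card => z; rewrite !inE common_upper_cover.
  case: P => /=; last by apply: eq_card0 => z; rewrite !inE andbF.
  by rewrite -(cards1 (x + y)%VS); apply: eq_card => z; rewrite !inE andbT.
transitivity #|[set z | (z == (x :&: y)%VS) && P]|; last first.
  by apply: eq_card => z; rewrite !inE common_lower_cover.
case: P => /=; last by apply/esym/eq_card0 => z; rewrite !inE andbF.
by rewrite -(cards1 (x :&: y)%VS); apply: eq_card => z; rewrite !inE andbT.
Qed.

(** * Invariant injective kernels between Grassmannians *)

Lemma raises_cover_mx : raises cover_mx dim_index.
Proof.
move=> i j; rewrite mxE /covers pnatr_eq0 eqb0 negbK.
by case/andP=> _ /eqP.
Qed.

Lemma raises_cover_mx_tr :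
  raises cover_mx^T (fun i => \dim {:V} - dim_index i)%N.
Proof.
move=> i j; rewrite mxE => /raises_cover_mx.
by have := dimvS (subvf (enum_val i)); rewrite -/(dim_index i); lia.
Qed.

(** The transposed covering matrix, graded by codimension, satisfies the same
relation as the covering matrix graded by dimension. *)
Lemma cover_mx_tr_commutator :
  cover_mx^T *m cover_mx^T^T - cover_mx^T^T *m cover_mx^T =
    diag_mx (\row_i rank_gap (\dim {:V} - dim_index i)).
Proof.
rewrite trmxK -[LHS]opprB cover_mx_commutator -linearN /=; congr diag_mx.
apply/rowP => i; rewrite !mxE /rank_gap opprB.
by rewrite subKn // /dim_index dimvS ?subvf.
Qed.

Lemma sum_rank_gap_gt0 r m : (0 < m)%N -> (r + r + m <= \dim {:V})%N ->
  0 < \sum_(i < m) rank_gap (r + i)%N.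
Proof.
apply: sum_qnum_gt0; apply: ltnW; exact: card_finNzRing_gt1.
Qed.

Lemma kernel_inj_up j k : (j <= k)%N -> (j + k <= \dim {:V})%N ->
  kernel_inj (grassmannian V j) (grassmannian V k) (chains (k - j)).
Proof.
move=> jk le_n; have -> : grassmannian V j = [set x | \dim x == j] by [].
have -> : grassmannian V k = [set x | \dim x == j + (k - j)]%N.
  by rewrite subnKC.
apply: (kernel_inj_exp raises_cover_mx cover_mx_commutator) => // m' lem.
by apply: sum_rank_gap_gt0; lia.
Qed.

Lemma kernel_inj_down j k :
    (k <= j <= \dim {:V})%N -> (\dim {:V} <= j + k)%N ->
  kernel_inj (grassmannian V j) (grassmannian V k)
    (fun x y => chains (j - k) y x).
Proof.
move=> /andP[kj jn] le_n; set n := \dim {:V} in jn le_n *.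
have grE l : (l <= n)%N -> grassmannian V l = [set x | n - \dim x == n - l]%N.
  move=> ln; apply/setP => x; rewrite !inE.
  by have : (\dim x <= n)%N := dimvS (subvf x); lia.
rewrite (grE j) // (grE k) ?(leq_trans kj) //.
have -> : (n - k = n - j + (j - k))%N by lia.
have -> : (fun x y => chains (j - k) y x) =
    (fun x y => (cover_mx^T ^+ (j - k)) (enum_rank x) (enum_rank y)).
  by apply: funext => x; apply: funext => y; rewrite -trmx_exp mxE.
apply: (kernel_inj_exp raises_cover_mx_tr cover_mx_tr_commutator) => // m' lem.
by apply: sum_rank_gap_gt0; lia.
Qed.

(** The kernels are invariant under linear automorphisms. *)
Lemma chains_inv (f : 'End(V)) m x y : lker f == 0%VS ->
  chains m (f @: x) (f @: y) = chains m x y.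
Proof.
move=> f0; have injf : injective (fun z : {vspace V} => f @: z)%VS.
  move=> z z' /eqP; rewrite eqEsubv !limg_ker0 // -eqEsubv.
  by move/eqP.
have dimf z : \dim (f @: z) = \dim z.
  by apply: limg_dim_eq; rewrite (eqP f0) capv0.
elim: m y => [|m IH] y; first by rewrite !chains0 (inj_eq injf).
rewrite -addn1 !sum_chains (reindex_inj injf) /=; apply: eq_bigr => z _.
by rewrite IH !chains1 /covers limg_ker0 // !dimf.
Qed.

End Covers.

Theorem proposition3p1 (F : finFieldType) (V : vectType F) (n : nat)
    (Hn : (1 <= n)%N) (HdimV : \dim {:V} = n)
    (G : groupType) (rho : G -> 'End(V)) (Hrho : linear_action rho)
    (j k : nat) (Hj : (1 <= j <= n.-1)%N) (Hk : (1 <= k <= n.-1)%N)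
    (Hjk : (#|grassmannian V j| <= #|grassmannian V k|)%N) :
  (num_orbits (subspace_act rho) (grassmannian V j)
     <= num_orbits (subspace_act rho) (grassmannian V k))%N.
Proof.
case: Hrho => rho1 rhoM.
have ker0 g : lker (rho g) == 0%VS.
  apply/lker0P => u v e.
  have inv w : w = rho g^-1%g (rho g w).
    by rewrite -comp_lfunE -rhoM mulVg rho1 id_lfunE.
  by rewrite (inv u) e -inv.
have act1 x : subspace_act rho 1%g x = x by rewrite /subspace_act rho1 lim1g.
have actM g h x :
    subspace_act rho (g * h)%g x = subspace_act rho g (subspace_act rho h x).
  by rewrite /subspace_act rhoM limg_comp.
have stable g x :
    (subspace_act rho g x \in grassmannian V j) = (x \in grassmannian V j).
  by rewrite !inE limg_dim_eq // (eqP (ker0 g)) capv0.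
have [jk|/ltnW kj] := leqP j k; have [jkn|/ltnW njk] := leqP (j + k) n.
- apply: (leq_num_orbits act1 actM (K := chains (k - j))) => //.
    by move=> g x y; apply: chains_inv.
  by apply: kernel_inj_up; rewrite ?HdimV.
- apply: (leq_num_orbits act1 actM (K := chains (k - j))) => //.
    by move=> g x y; apply: chains_inv.
  apply: (kernel_inj_tr _ Hjk).
  by apply: kernel_inj_down; rewrite ?HdimV; lia.
- apply: (leq_num_orbits act1 actM (K := fun x y => chains (j - k) y x)) => //.
    by move=> g x y; apply: chains_inv.
  apply: (kernel_inj_tr _ Hjk).
  by apply: kernel_inj_up; rewrite ?HdimV // addnC.
- apply: (leq_num_orbits act1 actM (K := fun x y => chains (j - k) y x)) => //.
    by move=> g x y; apply: chains_inv.
  by apply: kernel_inj_down; rewrite ?HdimV //; lia.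
Qed.
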